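(* Choose $\phi=\phi_{kl}$, $\phi_{kl}(t)=t\log t-t+1$. Then the problem $\min_{\mathbf w}\frac{1}{n_+}\sum_{\mathbf x_i\in\mathcal S_+}\hat L_\phi(\mathbf w;\mathbf x_i)$ becomes $$\min_{\mathbf w}\ \frac1{n_+}\sum_{\mathbf x_i\in\mathcal S_+}\lambda\log\Big(\frac1{n_-}\sum_{\mathbf x_j\in\mathcal S_-}\exp\Big(\frac{L(\mathbf w;\mathbf x_i,\mathbf x_j)}{\lambda}\Big)\Big)$$ (the two objectives agree for every $\mathbf w$ and every $\lambda>0$). If $\ell(\cdot)$ is monotonically decreasing where $\ell(\cdot)>0$, then when $\lambda=0$ this objective is the surrogate objective of $\widehat{\mathrm{OPAUC}}(h_{\mathbf w},0,\frac1{n_-})$, and when $\lambda=+\infty$ it is the surrogate objective of $\widehat{\mathrm{OPAUC}}(h_{\mathbf w},0,1)$, i.e. of the AUC.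
   Context: $\mathcal S_+$ and $\mathcal S_-$ are finite sets of positive and negative training examples, $n_+=|\mathcal S_+|$, $n_-=|\mathcal S_-|$. $h_{\mathbf w}(\mathbf x)\in\mathbb R$ is a score function with parameter $\mathbf w\in\mathbb R^d$, and $L(\mathbf w;\mathbf x_i,\mathbf x_j)=\ell(h_{\mathbf w}(\mathbf x_i)-h_{\mathbf w}(\mathbf x_j))$. Standing assumption on $\ell:\mathbb R\to\mathbb R$: it is convex, differentiable, monotonically decreasing where $\ell(\cdot)>0$, and $\ell'(0)<0$. For each positive example, $$\hat L_\phi(\mathbf w;\mathbf x_i)=\max_{\mathbf p\in\Delta}\ \sum_{\mathbf x_j\in\mathcal S_-}p_jL(\mathbf w;\mathbf x_i,\mathbf x_j)-\lambda D_\phi(\mathbf p,1/n_-),$$ where $\Delta$ is the probability simplex in $\mathbb R^{n_-}$, $\lambda>0$ and $D_\phi(\mathbf p,1/n_-)=\frac1{n_-}\sum_j\phi(n_-p_j)$; for $\phi=\phi_{kl}$ this is $\sum_jp_j\log(n_-p_j)$. For $\beta\in(0,1]$ with $n_-\beta$ a positive integer, the surrogate objective of $\widehat{\mathrm{OPAUC}}(h_{\mathbf w},0,\beta)$ (empirical one-way partial AUC with false positive rate in $[0,\beta]$) is $$\frac1{n_+}\sum_{\mathbf x_i\in\mathcal S_+}\frac1{n_-\beta}\sum_{\mathbf x_j\in\mathcal S_-^{\downarrow}[1,n_-\beta]}L(\mathbf w;\mathbf x_i,\mathbf x_j),$$ where $\mathcal S_-^{\downarrow}[k_1,k_2]$ is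 the set of negative examples whose rank in descending order of score $h_{\mathbf w}$ lies in $[k_1,k_2]$ (ties broken arbitrarily). Values $\lambda=0$ and $\lambda=+\infty$ of the objective are understood as the limits $\lambda\to0^+$ and $\lambda\to+\infty$. *)

(* Defs.v *)
From mathcomp Require Import all_boot all_order all_algebra finmap.
From mathcomp Require Import all_classical all_reals all_analysis.

Set Implicit Arguments.
Unset Strict Implicit.
Unset Printing Implicit Defensive.

Import Order.TTheory GRing.Theory Num.Theory.
Import numFieldNormedType.Exports.

Local Open Scope fset_scope.
Local Open Scope classical_set_scope.
Local Open Scope ring_scope.

Section Objectives.
Context {R : realType} {X : choiceType} {d : nat}.
Implicit Types (l : R -> R) (h : 'rV[R]_d -> X -> R) (w : 'rV[R]_d).
Implicit Types (Sp Sm : {fset X}) (x : X) (lam : R).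

(* Weak monotonicity of [l] restricted to the set where it is positive; the
   strictly decreasing case is included. *)
Definition decreasing_where_pos l : Prop :=
  forall s t : R, 0 < l s -> 0 < l t -> s <= t -> l t <= l s.

Definition pair_loss l h w x y : R := l (h w x - h w y).

Definition simplex (I : finType) : set (I -> R) :=
  [set p | (forall j, 0 <= p j) /\ \sum_j p j = 1].

(* [ln 0 = 0], so that [phi_kl 0 = 1], the continuous extension. *)
Definition phi_kl (t : R) : R := t * ln t - t + 1.

(* The phi-divergence from [p] to the uniform distribution on [I]. *)
Definition phi_div (phi : R -> R) (I : finType) (p : I -> R) : R :=
  #|I|%:R^-1 * \sum_j phi (#|I|%:R * p j).

Definition dro_value phi lam l h Sm w x (p : Sm -> R) : R :=
  \sum_(y : Sm) p y * pair_loss l h w x (val y) - lam * phi_div phi p.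

(* All the values whose maximum defines the robust loss at [x]. *)
Definition dro_values phi lam l h Sm w x : set R :=
  [set dro_value phi lam l h w x p | p in @simplex Sm].

Definition is_maximum (A : set R) (m : R) : Prop := A m /\ ubound A m.

Definition dro_loss phi lam l h Sm w x : R :=
  sup (dro_values phi lam l h Sm w x).

Definition dro_objective phi lam l h Sp Sm w : R :=
  #|` Sp|%:R^-1 * \sum_(x <- Sp) dro_loss phi lam l h Sm w x.

Definition kl_objective lam l h Sp Sm w : R :=
  #|` Sp|%:R^-1 * \sum_(x <- Sp)
    lam * ln (#|` Sm|%:R^-1 * \sum_(y <- Sm) expR (pair_loss l h w x y / lam)).

(* [rk] numbers [S] from 1 to the cardinality of [S] by descending score; any
   tie-breaking is allowed, and the values of [rk] outside [S] are irrelevant. *)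
Definition desc_ranking (S : {fset X}) (score : X -> R) (rk : X -> nat) : Prop :=
  [/\ {in S, forall y, (1 <= rk y <= #|` S|)%N},
      {in S &, injective rk} &
      {in S &, forall y z, score z < score y -> (rk y < rk z)%N}].

(* The bounds are reals because the upper one used below is [#|` S| * beta]. *)
Definition ranked_between (S : {fset X}) (rk : X -> nat) (k1 k2 : R) : {fset X} :=
  [fset y in S | k1 <= (rk y)%:R <= k2].

(* Meaningful for [0 < beta <= 1] with [#|` Sm| * beta] a positive integer, and
   [rk] a descending ranking of [Sm] for the score [h w]. *)
Definition opauc_surrogate (beta : R) l h Sp Sm (rk : X -> nat) w : R :=
  #|` Sp|%:R^-1 * \sum_(x <- Sp)
    ((#|` Sm|%:R * beta)^-1 *
     \sum_(y <- ranked_between Sm rk 1 (#|` Sm|%:R * beta)) pair_loss l h w x y).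

Definition auc_surrogate l h Sp Sm w : R :=
  (#|` Sp|%:R * #|` Sm|%:R)^-1 * \sum_(x <- Sp) \sum_(y <- Sm) pair_loss l h w x y.

Lemma desc_ranking_exists (S : {fset X}) (score : X -> R) :
  exists rk, desc_ranking S score rk.
Proof.
pose r := relpre score (>=%O : rel R).
have r_tot : total r by move=> y z; rewrite /r /= le_total.
have r_tr : transitive r by move=> b a c /= ab bc; exact: le_trans bc ab.
pose s := sort r S.
have mem_s y : (y \in s) = (y \in S) by rewrite mem_sort.
exists (fun y => (index y s).+1); split.
- move=> y yS; rewrite /=.
  by rewrite -(size_sort r S) index_mem mem_s.
- by move=> y z yS zS [] /index_inj; apply; rewrite ?mem_s.
- move=> y z yS zS lt_zy; rewrite ltnS ltnNge; apply/negP => le_zy.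
  have := sorted_leq_index r_tr _ (sort_sorted r_tot S).
  move=> /(_ _) H.
  have /H : reflexive r by move=> a; rewrite /r /=.
  move=> /(_ z y); rewrite !mem_s => /(_ zS yS le_zy) /=.
  by rewrite /r /= leNgt lt_zy.
Qed.

End Objectives.

(* Main.v *)
(* The duality gap of a weight vector p in the robust loss is lam times the
   relative entropy of p with respect to the softmax weights, so these weights
   attain the maximum, which is the log-mean-exp (Gibbs variational principle).
   The log-mean-exp lies within lam * log n of the maximal loss, hence the limit
   at 0; the uniform weights bound it below by the mean loss and log t <= t - 1
   bounds it above by lam * (mean of exp (L / lam) - 1), hence the limit at
   infinity. A convex l that is decreasing where positive is nonincreasing on
   the whole line, so the maximal loss is reached at the top-scored negative. *)
Require Import Defs.
From mathcomp Require Import all_boot all_order all_algebra finmap.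
From mathcomp Require Import all_classical all_reals all_analysis.
From mathcomp Require Import ring lra.

Set Implicit Arguments.
Unset Strict Implicit.
Unset Printing Implicit Defensive.

Import Order.TTheory GRing.Theory Num.Theory.
Import numFieldNormedType.Exports.

Local Open Scope fset_scope.
Local Open Scope classical_set_scope.
Local Open Scope ring_scope.

(** * Convex functions that decrease where positive *)

Lemma convex_chord (R : realType) (l : R -> R) (s t u : R) :
  convex_function [set: R^o] (l : R^o -> R^o) -> s < t -> t < u ->
  (u - s) * l t <= (u - t) * l s + (t - s) * l u.
Proof.
move=> l_convex lt_st lt_tu.
have us_gt0 : 0 < u - s by lra.
have a_ge0 : 0 <= (u - t) / (u - s) by rewrite divr_ge0 //; lra.
have a_le1 : (u - t) / (u - s) <= 1 by rewrite ler_pdivrMr //; lra.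
have le_conv := l_convex (Itv01 a_ge0 a_le1) s u (in_setT _) (in_setT _).
move: a_ge0 a_le1 le_conv; set a := (u - t) / (u - s) => a_ge0 a_le1 le_conv.
have {}le_conv : l (a * s + (1 - a) * u) <= a * l s + (1 - a) * l u := le_conv.
have -> : t = a * s + (1 - a) * u by rewrite /a; field; lra.
move: a a_ge0 a_le1 le_conv => a _ _ le_conv.
have -> : (u - (a * s + (1 - a) * u)) = (u - s) * a by ring.
have -> : (a * s + (1 - a) * u - s) = (u - s) * (1 - a) by ring.
by rewrite -!mulrA -mulrDr ler_pM2l.
Qed.

Lemma convex_decreasing_where_pos (R : realType) (l : R -> R) :
  convex_function [set: R^o] (l : R^o -> R^o) -> decreasing_where_pos l ->
  {homo l : s t /~ s <= t}.
Proof.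
move=> l_convex l_decr t s; rewrite le_eqVlt => /predU1P[-> //|lt_st].
rewrite leNgt; apply/negP => lt_l.
have d_gt0 : 0 < l t - l s by lra.
(* If [l s < l t], convexity makes [l] grow at least linearly beyond [t], so that
   it is eventually both positive and increasing. *)
have [k k_gt0 kd] : exists2 k : R, 0 < k & k * (l t - l s) = `|l t| + 1.
  exists ((`|l t| + 1) / (l t - l s)); last by field; lra.
  by rewrite divr_gt0 // ltr_wpDl.
(* The line through the graph points over [s] and [t] has height [l t + k * (l t - l s)] at [u],
   that is [l t + |l t| + 1 >= 1]; by convexity [l u] lies above it. *)
pose u := t + k * (t - s).
have lt_tu : t < u by rewrite /u ltrDl mulr_gt0 //; lra.
have lu : l t + `|l t| + 1 <= l u.
  have ts_gt0 : 0 < t - s by lra.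
  have := convex_chord l_convex lt_st lt_tu.
  have -> : u - s = (t - s) * (1 + k) by rewrite /u; ring.
  have -> : u - t = (t - s) * k by rewrite /u; ring.
  rewrite -!mulrA -mulrDr ler_pM2l // => le_chord.
  have : k * l t - k * l s = `|l t| + 1 by rewrite -kd; ring.
  rewrite mulrDl mul1r in le_chord. by lra.
have : - l t <= `|l t| by rewrite -normrN ler_norm.
have : l t <= `|l t| by rewrite ler_norm.
move=> le1 le2.
(* [u] is the midpoint of [s] and [u + (u - s)], and [l s < l u], so convexity puts the value at the
   right end above [l u]. Both values are positive, which contradicts [l_decr]. *)
have lt_uv : u < u + (u - s) by lra.
have lt_su : s < u by lra.
have := convex_chord l_convex lt_su lt_uv.
have -> : u + (u - s) - s = (u - s) * 2 by ring.
have -> : u + (u - s) - u = u - s by ring.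
have us_gt0 : 0 < u - s by lra.
rewrite -!mulrA -mulrDr ler_pM2l // => le_chord.
have : l (u + (u - s)) <= l u by apply: l_decr; lra.
by lra.
Qed.

(** * Elementary bounds and limits for [ln] and [expR] *)

Lemma ln_le_subr1 (R : realType) (x : R) : 0 < x -> ln x <= x - 1.
Proof.
by move=> x_gt0; rewrite -[X in ln X](subrKC 1) le_ln1Dx // ltrBrDl addrN.
Qed.

Lemma cvg_inv_pinfty (R : realType) : lam^-1 @[lam --> +oo] --> (0 : R).
Proof.
apply/cvgrVy.
  near=> lam; rewrite invr_gt0; near: lam; exact: nbhs_pinfty_gt.
have -> : unstable.inv_fun (fun x : R => x^-1) = id; last exact: cvg_id.
by apply/funext => x; exact: invrK.
Unshelve. all: by end_near. Qed.

(** A squeeze using [1 + t <= expR t] twice: at [a / lam] it gives the lower bound [a]; at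
    [- a / lam], inverted once [a < lam], it gives the upper bound [a / (1 - a / lam)]. *)
Lemma expR_scaled_cvg (R : realType) (a : R) :
  lam * (expR (a / lam) - 1) @[lam --> +oo] --> a.
Proof.
apply: (@squeeze_cvgr _ _ _ _ (fun=> a) (fun lam => a / (1 - a * lam^-1))).
- near=> lam.
  have lam_gt0 : 0 < lam by near: lam; exact: nbhs_pinfty_gt.
  have lt_a : a < lam by near: lam; apply: nbhs_pinfty_gt; exact: num_real.
  have al1 : a / lam < 1 by rewrite ltr_pdivrMr ?mul1r.
  apply/andP; split.
    by rewrite -ler_pdivrMl // mulrC lerBrDl expR_ge1Dx.
  have e_le : expR (a / lam) <= (1 - a / lam)^-1.
    rewrite -[leLHS]invrK -expRN lef_pV2 ?posrE ?expR_gt0 ?subr_gt0 //.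
    exact: expR_ge1Dx.
  apply: (@le_trans _ _ (lam * ((1 - a / lam)^-1 - 1))).
    by rewrite ler_pM2l // lerB.
  rewrite le_eqVlt; apply/orP; left; apply/eqP; field.
  by rewrite lt0r_neq0 //= subr_eq0 gt_eqF.
- exact: cvg_cst.
- have {3}-> : a = a / (1 - a * 0) by rewrite mulr0 subr0 invr1 mulr1.
  apply: cvgM; first exact: cvg_cst.
  apply: cvgV; first by rewrite mulr0 subr0 oner_neq0.
  apply: cvgB; first exact: cvg_cst.
  by apply: cvgMl_tmp; exact: cvg_inv_pinfty.
Unshelve. all: by end_near. Qed.

(** * Log-mean-exp and the Gibbs variational principle *)

Definition log_mean_exp (R : realType) (I : finType) (lam : R) (f : I -> R) : R :=
  lam * ln (#|I|%:R^-1 * \sum_j expR (f j / lam)).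

Section LogMeanExp.
Context {R : realType} {I : finType} (I_gt0 : (0 < #|I|)%N).
Implicit Types (f p : I -> R) (lam : R).

Let n_gt0 : 0 < #|I|%:R :> R. Proof. by rewrite ltr0n. Qed.

Lemma sum_expR_gt0 f : 0 < \sum_j expR (f j).
Proof.
have /card_gt0P[i _] := I_gt0.
rewrite (bigD1 i) //= ltr_wpDr ?expR_gt0 ?sumr_ge0 // => j _; exact: expR_ge0.
Qed.

Lemma log_mean_expE lam f : log_mean_exp lam f =
  lam * (ln (\sum_j expR (f j / lam)) - ln #|I|%:R).
Proof.
by rewrite /log_mean_exp [_^-1 * _]mulrC ln_div ?posrE ?sum_expR_gt0.
Qed.

Lemma phi_div_klE p : simplex p ->
  phi_div phi_kl p = \sum_j p j * ln (#|I|%:R * p j).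
Proof.
move=> [_ p1]; rewrite /phi_div /phi_kl big_split/= big_split/= sumrN.
rewrite -mulr_sumr p1 sumr_const mulr1 addrNK mulr_sumr.
apply: eq_bigr => j _; rewrite !mulrA mulVf ?mul1r //; exact: lt0r_neq0.
Qed.

Definition softmax lam f (j : I) : R :=
  expR (f j / lam) / \sum_k expR (f k / lam).

Lemma softmax_gt0 lam f j : 0 < softmax lam f j.
Proof. by rewrite divr_gt0 ?expR_gt0 ?sum_expR_gt0. Qed.

Lemma softmax_simplex lam f : simplex (softmax lam f).
Proof.
split=> [j|]; first exact/ltW/softmax_gt0.
by rewrite -mulr_suml divff //; apply/lt0r_neq0/sum_expR_gt0.
Qed.

(* The duality gap is [lam] times the relative entropy of [p] with respect to
   the softmax weights. *)
Lemma kl_gap lam f p : 0 < lam -> simplex p ->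
  \sum_j p j * f j - lam * phi_div phi_kl p =
  log_mean_exp lam f + lam * \sum_j p j * (ln (softmax lam f j) - ln (p j)).
Proof.
move=> lam_gt0 ps; have [p_ge0 p1] := ps.
(* Multiplying the constant part of the log-mean-exp by [1 = \sum_j p j] reduces the identity to one
   term per index; where [p j = 0] both terms vanish. *)
rewrite log_mean_expE -mulrDr -[X in lam * (X + _)]mulr1 -[X in lam * (_ * X + _)]p1 mulr_sumr.
rewrite (phi_div_klE ps) -big_split/= !mulr_sumr -sumrB.
apply: eq_bigr => j _; rewrite /softmax.
rewrite ln_div ?posrE ?expR_gt0 ?sum_expR_gt0 // expRK.
have := p_ge0 j; rewrite le_eqVlt => /predU1P[<-|pj_gt0].
  by rewrite !(mul0r, mulr0, addr0, subr0).
rewrite lnM ?posrE //. field; exact: lt0r_neq0.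
Qed.

(** This is [ln t <= t - 1] at [t = b / a], multiplied by [a]. Summed over two probability vectors
    it yields the Gibbs inequality. *)
Lemma mul_ln_sub_le (a b : R) : 0 <= a -> 0 < b ->
  a * (ln b - ln a) <= b - a.
Proof.
rewrite le_eqVlt => /predU1P[<-|a_gt0] b_gt0; first by rewrite mul0r subr0 ltW.
rewrite -ln_div ?posrE // -ler_pdivlMl //.
rewrite (le_trans (ln_le_subr1 (divr_gt0 b_gt0 a_gt0))) // mulrBr mulVf ?gt_eqF //.
by rewrite mulrC.
Qed.

Lemma kl_value_le lam f p : 0 < lam -> simplex p ->
  \sum_j p j * f j - lam * phi_div phi_kl p <= log_mean_exp lam f.
Proof.
move=> lam_gt0 ps; rewrite kl_gap // gerDl pmulr_rle0 //.
have [p_ge0 p1] := ps.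
(* Both [p] and the softmax weights sum to 1, so the termwise bounds add up to 0. *)
rewrite (le_trans (ler_sum _ (fun j _ =>
  mul_ln_sub_le (p_ge0 j) (softmax_gt0 lam f j)))) //.
by rewrite sumrB p1 (softmax_simplex lam f).2 subrr.
Qed.

Lemma kl_value_softmax lam f : 0 < lam ->
  \sum_j softmax lam f j * f j - lam * phi_div phi_kl (softmax lam f) =
  log_mean_exp lam f.
Proof.
move=> lam_gt0; rewrite kl_gap //; last exact: softmax_simplex.
by rewrite big1 ?mulr0 ?addr0 // => j _; rewrite subrr mulr0.
Qed.

(** * Bounds on log-mean-exp and its limits at 0 and infinity *)

Lemma mean_le_log_mean_exp lam f : 0 < lam ->
  #|I|%:R^-1 * \sum_j f j <= log_mean_exp lam f.
Proof.
move=> lam_gt0; have n_neq0 := lt0r_neq0 n_gt0.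
have unif : @simplex R I (fun=> #|I|%:R^-1).
  split=> [_|]; first by rewrite invr_ge0 ltW.
  by rewrite sumr_const -[LHS]mulr_natr mulVf.
apply: le_trans (kl_value_le f lam_gt0 unif).
rewrite phi_div_klE // mulfV // ln1 [X in lam * X]big1.
  by rewrite mulr0 subr0 mulr_sumr.
by move=> j _; rewrite mulr0.
Qed.

Lemma log_mean_exp_le lam f (m : R) : 0 < lam -> (forall j, f j <= m) ->
  log_mean_exp lam f <= m.
Proof.
move=> lam_gt0 f_le; rewrite /log_mean_exp -ler_pdivlMl //.
rewrite -[leRHS]expRK ler_ln ?posrE ?expR_gt0 //; last first.
  by rewrite mulr_gt0 ?invr_gt0 ?sum_expR_gt0.
rewrite ler_pdivrMl // mulr_natl -sumr_const ler_sum // => j _.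
by rewrite ler_expR mulrC ler_pM2l // invr_gt0.
Qed.

(** Only the [i]-th exponential is kept in the sum; the factor [1 / n] costs [lam * ln n]. *)
Lemma log_mean_exp_ge lam f i : 0 < lam ->
  f i - lam * ln #|I|%:R <= log_mean_exp lam f.
Proof.
move=> lam_gt0; rewrite log_mean_expE mulrBr lerD2r -ler_pdivrMl // mulrC.
rewrite -[leLHS]expRK ler_ln ?posrE ?expR_gt0 ?sum_expR_gt0 //.
by rewrite (bigD1 i) //= lerDl sumr_ge0 // => j _; exact: expR_ge0.
Qed.

Lemma log_mean_exp_cvg0 f i : (forall j, f j <= f i) ->
  log_mean_exp lam f @[lam --> 0^'+] --> f i.
Proof.
move=> f_le.
apply: (@squeeze_cvgr _ _ _ _ (fun lam => f i - lam * ln #|I|%:R) (fun=> f i)).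
- near=> lam.
  have lam_gt0 : 0 < lam by near: lam; exact: nbhs_right_gt.
  by rewrite log_mean_exp_ge // log_mean_exp_le.
- apply: cvg_at_right_filter.
  rewrite -[X in _ --> X]subr0 -[X in _ - X](mul0r (ln #|I|%:R)).
  by apply: cvgB; [exact: cvg_cst | apply: cvgMr_tmp; exact: cvg_id].
- exact: cvg_cst.
Unshelve. all: by end_near. Qed.

Lemma log_mean_exp_cvgy f :
  log_mean_exp lam f @[lam --> +oo] --> #|I|%:R^-1 * \sum_j f j.
Proof.
have n_neq0 := lt0r_neq0 n_gt0.
apply: (@squeeze_cvgr _ _ _ _ (fun=> #|I|%:R^-1 * \sum_j f j)
  (fun lam => #|I|%:R^-1 * \sum_j lam * (expR (f j / lam) - 1))).
- near=> lam.
  have lam_gt0 : 0 < lam by near: lam; exact: nbhs_pinfty_gt.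
  rewrite mean_le_log_mean_exp //= /log_mean_exp.
  set A := _ * \sum_j expR _.
  have A_gt0 : 0 < A by rewrite mulr_gt0 ?invr_gt0 ?sum_expR_gt0.
  apply: (@le_trans _ _ (lam * (A - 1))).
    by rewrite ler_pM2l // ln_le_subr1.
  rewrite -mulr_sumr mulrCA ler_pM2l // sumrB sumr_const.
  by rewrite [leRHS]mulrBr mulVf.
- exact: cvg_cst.
- apply: cvgMl_tmp; apply: cvg_big => [|j _]; first exact: add_continuous.
  exact: expR_scaled_cvg.
Unshelve. all: by end_near. Qed.

End LogMeanExp.

(** Rank minus one injects [S] into the ordinals below its cardinality, hence is a bijection, so
    some element has rank 1. *)
Lemma desc_ranking_top (R : realType) (X : choiceType) (S : {fset X})
    (score : X -> R) (rk : X -> nat) :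
  S != fset0 -> desc_ranking S score rk ->
  exists2 y0, y0 \in S & rk y0 = 1%N /\ {in S, forall y, score y <= score y0}.
Proof.
move=> S_neq0 [rk_bnd rk_inj rk_mono].
have n_gt0 : (0 < #|fset_sub_type S|)%N by rewrite -cardfE cardfs_gt0.
have rk_lt (y : S) : ((rk (val y)).-1 < #|fset_sub_type S|)%N.
  by have /andP[rk_gt0 rk_le] := rk_bnd _ (valP y); rewrite -cardfE prednK.
pose pos y := Ordinal (rk_lt y).
have pos_inj : injective pos.
  move=> y z [] eq_yz; apply/val_inj/rk_inj; [exact: valP | exact: valP |].
  have /andP[y_gt0 _] := rk_bnd _ (valP y).
  have /andP[z_gt0 _] := rk_bnd _ (valP z).
  by rewrite -(prednK y_gt0) -(prednK z_gt0) eq_yz.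
have [top _ topK] := inj_card_bij pos_inj (eq_leq (card_ord _)).
have rk1 : rk (val (top (Ordinal n_gt0))) = 1%N.
  have /andP[top_gt0 _] := rk_bnd _ (valP (top (Ordinal n_gt0))).
  have /(congr1 val)/= rk0 := topK (Ordinal n_gt0).
  by rewrite -(prednK top_gt0) rk0.
exists (val (top (Ordinal n_gt0))); first exact: valP.
split=> // y yS; rewrite leNgt; apply/negP => lt_score.
(* A strictly larger score would force a rank below 1. *)
have := rk_mono _ _ yS (valP _) lt_score; rewrite rk1 ltnS leqNgt.
by have /andP[-> _] := rk_bnd _ yS.
Qed.

Lemma sup_is_maximum (R : realType) (A : set R) (m : R) :
  is_maximum A m -> sup A = m.
Proof.
move=> [Am ubm]; apply/eqP; rewrite eq_le ge_sup //; last by exists m.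
by rewrite ub_le_sup //; exists m.
Qed.

(** * From log-mean-exp to the training objectives *)

Section Objectives.
Context {R : realType} {X : choiceType} {d : nat}.
Implicit Types (l : R -> R) (h : 'rV[R]_d -> X -> R) (w : 'rV[R]_d).
Implicit Types (Sp Sm : {fset X}) (x : X) (lam : R).

Lemma fset_card_gt0 Sm : Sm != fset0 -> (0 < #|fset_sub_type Sm|)%N.
Proof. by rewrite -cardfs_gt0 cardfE. Qed.

Lemma kl_objectiveE lam l h Sp Sm w : kl_objective lam l h Sp Sm w =
  #|` Sp|%:R^-1 * \sum_(x <- Sp)
    log_mean_exp lam (fun y : Sm => pair_loss l h w x (val y)).
Proof.
congr (_ * _); apply: eq_bigr => x _.
by rewrite /log_mean_exp cardfE big_seq_fsetE.
Qed.

Lemma dro_values_maximum lam l h Sm w x : Sm != fset0 -> 0 < lam ->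
  is_maximum (dro_values phi_kl lam l h Sm w x)
    (log_mean_exp lam (fun y : Sm => pair_loss l h w x (val y))).
Proof.
move=> /fset_card_gt0 n_gt0 lam_gt0; split.
  exists (softmax lam (fun y : Sm => pair_loss l h w x (val y))).
    exact: softmax_simplex.
  exact: kl_value_softmax.
by move=> _ [p ps <-]; exact: kl_value_le.
Qed.

(** An arbitrary filter lets this serve both at [0^'+] and at [+oo]. *)
Lemma kl_objective_cvg (F : set_system R) (FF : Filter F) l h Sp Sm w
    (a : X -> R) :
  (forall x, log_mean_exp lam (fun y : Sm => pair_loss l h w x (val y))
     @[lam --> F] --> a x) ->
  kl_objective lam l h Sp Sm w @[lam --> F]
    --> #|` Sp|%:R^-1 * \sum_(x <- Sp) a x.
Proof.
move=> cvg_a; under eq_fun do rewrite kl_objectiveE.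
apply: cvgMl_tmp; apply: cvg_big => [|x _]; first exact: add_continuous.
exact: cvg_a.
Qed.

Lemma opauc_surrogate1 l h Sp Sm (rk : X -> nat) w :
  desc_ranking Sm (h w) rk ->
  opauc_surrogate 1 l h Sp Sm rk w =
  #|` Sp|%:R^-1 * \sum_(x <- Sp)
    (#|` Sm|%:R^-1 * \sum_(y <- Sm) pair_loss l h w x y).
Proof.
move=> [rk_bnd _ _]; rewrite /opauc_surrogate mulr1.
suff -> : ranked_between Sm rk 1 (#|` Sm|%:R : R) = Sm by [].
apply/fsetP => y; rewrite !inE /=; case: (boolP (y \in Sm)) => //= ySm.
by have /andP[rk_ge rk_le] := rk_bnd _ ySm; rewrite ler1n rk_ge ler_nat.
Qed.

(** The rank window collapses to [[1, 1]], and injectivity of [rk] leaves only [y0] in it. *)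
Lemma opauc_surrogate_inv_card l h Sp Sm (rk : X -> nat) w y0 :
  Sm != fset0 -> desc_ranking Sm (h w) rk -> y0 \in Sm -> rk y0 = 1%N ->
  opauc_surrogate #|` Sm|%:R^-1 l h Sp Sm rk w =
  #|` Sp|%:R^-1 * \sum_(x <- Sp) pair_loss l h w x y0.
Proof.
move=> Sm_neq0 [_ rk_inj _] y0S rk1; rewrite /opauc_surrogate.
rewrite mulfV; last by rewrite pnatr_eq0 -lt0n cardfs_gt0.
suff -> : ranked_between Sm rk (1 : R) 1 = [fset y0].
  by under eq_bigr do rewrite invr1 mul1r big_seq_fset1.
apply/fsetP => y; rewrite !inE /=; apply/andP/eqP => [[yS]|->].
  rewrite -eq_le eq_sym pnatr_eq1 => /eqP rky.
  by apply: rk_inj => //; rewrite rk1.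
by rewrite y0S rk1 lexx.
Qed.

End Objectives.

Theorem theorem2 (R : realType) (X : choiceType) (d : nat)
  (h : 'rV[R]_d -> X -> R) (Sp Sm : {fset X})
  (Sp_neq0 : Sp != fset0) (Sm_neq0 : Sm != fset0)
  (l : R -> R)
  (l_convex : convex_function [set: R^o] (l : R^o -> R^o))
  (l_derivable : forall s : R, derivable l s 1)
  (l'0_lt0 : derive1 l 0 < 0) :
  (forall lam : R, 0 < lam ->
     (forall (w : 'rV[R]_d) (x : X), x \in Sp ->
        is_maximum (dro_values phi_kl lam l h Sm w x)
                   (dro_loss phi_kl lam l h Sm w x)) /\
     (forall w : 'rV[R]_d,
        dro_objective phi_kl lam l h Sp Sm w = kl_objective lam l h Sp Sm w)) /\
  (decreasing_where_pos l ->
   forall (w : 'rV[R]_d) (rk : X -> nat), desc_ranking Sm (h w) rk ->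
     [/\ kl_objective lam l h Sp Sm w @[lam --> 0^'+]
           --> opauc_surrogate (#|` Sm|%:R^-1) l h Sp Sm rk w,
         kl_objective lam l h Sp Sm w @[lam --> +oo]
           --> opauc_surrogate 1 l h Sp Sm rk w &
         opauc_surrogate 1 l h Sp Sm rk w = auc_surrogate l h Sp Sm w]).
Proof.
split=> [lam lam_gt0|l_decr w rk rkP].
  have dro_lossE w x : dro_loss phi_kl lam l h Sm w x =
      log_mean_exp lam (fun y : Sm => pair_loss l h w x (val y)).
    exact/sup_is_maximum/dro_values_maximum.
  split=> [w x _|w]; first by rewrite dro_lossE; exact: dro_values_maximum.
  by rewrite kl_objectiveE; congr (_ * _); apply: eq_bigr => x _; rewrite dro_lossE.
have n_gt0 := fset_card_gt0 Sm_neq0.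
split.
- have [y0 y0S [rk1 y0_top]] := desc_ranking_top Sm_neq0 rkP.
  rewrite (opauc_surrogate_inv_card _ _ Sm_neq0 rkP y0S rk1).
  apply: kl_objective_cvg => x.
  apply: (log_mean_exp_cvg0 n_gt0 (i := [` y0S])) => y.
  (* The score of the negative enters the argument of [l] with a minus sign, so the top score gives
     the smallest argument and the largest loss, for every [x]. *)
  apply: (convex_decreasing_where_pos l_convex l_decr).
  by rewrite lerB // y0_top //; exact: valP.
- rewrite opauc_surrogate1 //; apply: kl_objective_cvg => x.
  rewrite cardfE big_seq_fsetE; exact: log_mean_exp_cvgy.
- by rewrite opauc_surrogate1 // /auc_surrogate invfM -mulr_sumr mulrA.
Qed.
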